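(* Let $G$ be a finite group, let $P$ be a probability on $G$ which is constant on every conjugacy class of $G$, let $U$ be the uniform probability on $G$, let $t\in\mathbb{N}$, and let $S\subset\widehat{G}^*$. Then $$\left|d_1\left(P^{*t},U\right)-\frac{1}{|G|}\sum_{g\in G}\left|\sum_{\alpha\in S}d_\alpha s_\alpha^t\,\overline{\mathrm{ch}^\alpha(g)}\right|\right|\leq\sum_{\alpha\in\widehat{G}^*\setminus S}d_\alpha|s_\alpha|^t.$$
   Context: $\widehat{G}$ is the set of (isomorphism classes of) irreducible complex representations of $G$, and $\widehat{G}^*=\widehat{G}\setminus\{\mathrm{triv}\}$, where $\mathrm{triv}$ is the trivial representation. For $\alpha\in\widehat{G}$, $\rho^\alpha$ denotes the representation matrix, $\mathrm{ch}^\alpha$ its character and $d_\alpha$ its dimension. The Fourier transform of $f:G\to\mathbb{C}$ is $\widehat{f}(\alpha)=\sum_{g\in G}f(g)\rho^\alpha(g)$. Since $P$ is constant on conjugacy classes, $\widehat{P}(\alpha)$ is a scalar matrix, with ratio $s_\alpha=\frac{\mathrm{Tr}(\widehat{P}(\alpha))}{d_\alpha}=\frac{1}{d_\alpha}\sum_{g\in G}P(g)\mathrm{ch}^\alpha(g)$. $P^{*t}$ is the $t$-fold convolution power of $P$, and $d_1(\mu,\nu)=\sum_{g\in G}|\mu(g)-\nu(g)|$. *)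

(* Defs.v *)
From mathcomp Require Import all_boot all_order all_algebra all_fingroup.
From mathcomp Require Import mxrepresentation reals complex.

Set Implicit Arguments.
Unset Strict Implicit.
Unset Printing Implicit Defensive.

Import Order.TTheory GRing.Theory Num.Theory.

Local Open Scope ring_scope.
Local Open Scope complex_scope.

(* Functions on the group G are total functions on the ambient type gT, of which
   only the values at elements of G matter. *)

Section Probabilities.

Variables (R : realType) (gT : finGroupType) (G : {group gT}).
Implicit Types (P mu nu : gT -> R) (t : nat).

Definition is_prob P :=
  {in G, forall g, 0 <= P g} /\ \sum_(g in G) P g = 1.

Definition class_invariant P := {in G &, forall g h, P (g ^ h)%g = P g}.

Definition unif (g : gT) : R := #|G|%:R^-1.

Definition dirac1 (g : gT) : R := (g == 1%g)%:R.

Definition convol mu nu (g : gT) : R :=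
  \sum_(h in G) mu h * nu (h^-1 * g)%g.

Definition convol_pow P t : gT -> R := iter t (convol P) dirac1.

Definition dist1 mu nu : R := \sum_(g in G) `|mu g - nu g|.

End Probabilities.

Section Representations.

Variables (R : realType) (gT : finGroupType) (G : {group gT}).

(* An element of this finite type is an isotypic component of the regular
   representation of G over R[i]; as the characteristic is 0, every irreducible
   representation is similar to irr_repr alpha for exactly one alpha
   (rsim_irr_comp_pchar, irr_reprK_pchar). *)
Definition Ghat : irrType R[i] G := DecSocleType (regular_repr R[i] G).

Definition triv : Ghat := principal_comp Ghat.

Definition Ghat_star : {set Ghat} := [set~ triv].

Definition rho (alpha : Ghat) : gT -> 'M[R[i]]_(irr_degree alpha) :=
  irr_repr alpha.

Definition ch (alpha : Ghat) (g : gT) : R[i] := \tr (rho alpha g).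

Definition irr_dim (alpha : Ghat) : R[i] := (irr_degree alpha)%:R.

Definition fourier (f : gT -> R[i]) (alpha : Ghat) :
    'M[R[i]]_(irr_degree alpha) :=
  \sum_(g in G) f g *: rho alpha g.

Definition fourier_ratio (P : gT -> R) (alpha : Ghat) : R[i] :=
  \tr (fourier (fun g => (P g)%:C) alpha) / irr_dim alpha.

End Representations.

(* Main.v *)
(** By Fourier inversion on G and Schur's lemma,
    P^{*t}(g) - U(g) = |G|^{-1} \sum_{alpha <> triv} d_alpha s_alpha^t conj(ch^alpha(g)),
    the trivial representation accounting for U.  Two applications of the
    triangle inequality bound the left-hand side of the theorem by
    \sum_{alpha notin S} d_alpha |s_alpha|^t * |G|^{-1} \sum_g |ch^alpha(g)|,
    and the last average is at most 1 because ch^alpha has L^2-norm 1. *)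

Require Import Defs.
From mathcomp Require Import all_boot all_order all_algebra all_fingroup.
From mathcomp Require Import mxrepresentation reals complex.

Import Order.TTheory GRing.Theory Num.Theory.
Local Open Scope ring_scope.
Local Open Scope complex_scope.

(** Right translation by [g] permutes the basis indexed by G and fixes a basis element only if [g]
    is 1, so every diagonal entry is [(g == 1)]. *)
Lemma regular_mxtrace (F : fieldType) (gT : finGroupType) (G : {group gT})
    (g : gT) : g \in G ->
  \tr (regular_repr F G g) = #|G|%:R * (g == 1%g)%:R.
Proof.
move=> Gg; rewrite mulr_natl -[X in _ *+ X]card_ord -sumr_const.
apply: eq_bigr => i _; rewrite !mxE /=.
have Gi := enum_valP i.
rewrite -(inj_eq enum_val_inj) gring_indexK ?groupM //.
by rewrite -{1}[enum_val i]mulg1 (inj_eq (mulgI _)) eq_sym.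
Qed.

Lemma mxtrace_delta (R : pzSemiRingType) n (i j : 'I_n) :
  \tr (delta_mx i j : 'M[R]_n) = (i == j)%:R.
Proof.
rewrite /mxtrace (bigD1 i) //= big1 ?addr0 => [|k ki].
  by rewrite mxE eqxx.
by rewrite mxE (negPf ki).
Qed.

(** * Characters of a single representation: inverses, Schur's lemma, norms *)

Section CharacterNorm.

Variables (C : numClosedFieldType) (gT : finGroupType) (G : {group gT}).
Variables (n : nat) (rG : mx_representation C G n).

(** The diagonal entries of A A^* are the squared Hermitian norms of the rows of A. *)
Lemma mul_mx_conjT_eq0 m p (A : 'M[C]_(m, p)) :
  (forall i, (A *m (map_mx Num.conj A)^T) i i = 0) -> A = 0.
Proof.
move=> AA0; apply/matrixP=> i j; rewrite [RHS]mxE.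
have := AA0 i; rewrite mxE => /psumr_eq0P.
have nneg k : true -> 0 <= A i k * (map_mx Num.conj A)^T k i.
  by rewrite !mxE -normCK exprn_ge0.
move=> /(_ nneg j isT); rewrite !mxE -normCK => /eqP.
by rewrite expf_eq0 normr_eq0 => /andP[_ /eqP].
Qed.

(* Averaging the standard Hermitian form over G gives an invertible A with
   rG g A (rG g)^* = A, so that rG (g^-1) is conjugate to (rG g)^*. *)
Lemma mxtrace_reprV g : g \in G -> \tr (rG g^-1%g) = (\tr (rG g))^*%R.
Proof.
move=> Gg; pose adj m p (M : 'M[C]_(m, p)) := (map_mx Num.conj M)^T.
have adjM m p q (M : 'M_(m, p)) (N : 'M_(p, q)) :
  adj _ _ (M *m N) = adj _ _ N *m adj _ _ M.
  by rewrite /adj map_mxM trmx_mul.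
pose A := \sum_(h in G) rG h *m adj _ _ (rG h).
have gA : rG g *m A *m adj _ _ (rG g) = A.
  rewrite /A mulmx_sumr mulmx_suml [RHS](reindex_inj (mulgI g)) /=.
  apply: eq_big => [h|h Gh]; first by rewrite groupMl.
  by rewrite repr_mxM // adjM !mulmxA.
have Aunit : A \in unitmx.
  (* For a row v with v A = 0, the number v A v^* is the sum over h of the squared norms of v (rG
     h). All of these vanish, and h = 1 gives v = 0. *)
  rewrite -row_free_unit -kermx_eq0; apply/eqP; set K := kermx A.
  have KA : K *m A *m adj _ _ K = 0 by rewrite mulmx_ker mul0mx.
  apply: mul_mx_conjT_eq0 => i.
  move/matrixP/(_ i i): KA; rewrite [RHS]mxE.
  rewrite /A mulmx_sumr mulmx_suml summxE => /psumr_eq0P KA.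
  have := KA _ 1%g (group1 G); rewrite repr_mx1 /adj map_mx1 trmx1 !mulmx1.
  apply=> h _; rewrite mulmxA -mulmxA -adjM mxE sumr_ge0 // => j _.
  by rewrite !mxE -normCK exprn_ge0.
have -> : rG g^-1%g = A *m adj _ _ (rG g) *m invmx A.
  apply: (canRL (mulmxK Aunit)).
  by rewrite -{1}gA !mulmxA -repr_mxM ?groupV // mulVg repr_mx1 mul1mx.
rewrite -mulmxA mxtrace_mulC -mulmxA mulVmx // mulmx1.
by rewrite mxtrace_tr trace_map_mx.
Qed.

Lemma centgmx_class_sum (f : gT -> C) :
  {in G &, forall g h, f (g ^ h)%g = f g} ->
  centgmx rG (\sum_(g in G) f g *: rG g).
Proof.
move=> fcl; apply/centgmxP => h Gh; rewrite mulmx_suml mulmx_sumr.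
rewrite [RHS](reindex_inj (conjg_inj h)) /=.
apply: eq_big => [g|g Gg]; first by rewrite groupJr.
by rewrite fcl // -scalemxAl -scalemxAr -!repr_mxM ?groupJ // -conjgC.
Qed.

Hypothesis irrG : mx_irreducible rG.

(** Schur's lemma: over an algebraically closed field irreducibility is absolute, so the centralizer
    consists of scalars, and the trace recovers the scalar. *)
Lemma mx_irr_cent_scalar A : centgmx rG A -> A = (\tr A / n%:R)%:M.
Proof.
have absG := group_closure_closed_field irrG.
have n_neq0 : n%:R != 0 :> C.
  by rewrite pnatr_eq0 -lt0n; case/mx_irrP: irrG.
move/(mx_abs_irr_cent_scalar absG)/is_scalar_mxP => [a ->].
by rewrite mxtrace_scalar -[a *+ n]mulr_natr mulfK.
Qed.

(** Reindexing by left translation shows that the sum commutes with the action, so Schur's lemma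
    applies; each summand has the trace of M. *)
Lemma sum_repr_conj (M : 'M[C]_n) :
  \sum_(g in G) rG g *m M *m rG g^-1%g = (#|G|%:R * \tr M / n%:R)%:M.
Proof.
rewrite [LHS]mx_irr_cent_scalar.
  congr (_ / _)%:M; rewrite raddf_sum /= mulr_natl -sumr_const.
  apply: eq_bigr => g Gg.
  by rewrite mxtrace_mulC mulmxA -repr_mxM ?groupV // mulVg repr_mx1 mul1mx.
apply/centgmxP => h Gh; rewrite mulmx_suml mulmx_sumr.
rewrite (reindex_inj (mulgI h)) /=.
apply: eq_big => [g|g]; rewrite groupMl // => Gg.
by rewrite invMg !repr_mxM ?groupV // !mulmxA repr_mxKV.
Qed.

Lemma sum_sqr_norm_character :
  \sum_(g in G) `|\tr (rG g)| ^+ 2 = #|G|%:R :> C.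
Proof.
have n_neq0 : n%:R != 0 :> C.
  by rewrite pnatr_eq0 -lt0n; case/mx_irrP: irrG.
(* Taking M to be the matrix unit at (i, j), the (i, j) entry of each summand is (rG g)_ii (rG
   g^-1)_jj. Summing over i and j gives the product of the two traces, which is the squared modulus
   of the character. *)
transitivity (\sum_i \sum_j
    (\sum_(g in G) rG g *m delta_mx i j *m rG g^-1%g) i j).
  under [RHS]eq_bigr => i _ do under eq_bigr => j _ do rewrite summxE.
  under [RHS]eq_bigr => i _ do rewrite exchange_big.
  rewrite [RHS]exchange_big /=; apply: eq_bigr => g Gg.
  rewrite normCK -mxtrace_reprV // mulr_suml; apply: eq_bigr => i _.
  rewrite mulr_sumr; apply: eq_bigr => j _.
  rewrite mxE (bigD1 j) //= big1 ?addr0 => [|k jk].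
    rewrite mxE (bigD1 i) //= big1 ?addr0 => [|k ik].
      by rewrite mxE !eqxx mulr1.
    by rewrite mxE (negPf ik) mulr0.
  by rewrite mxE big1 ?mul0r // => l _; rewrite mxE (negPf jk) andbF mulr0.
under eq_bigr => i _ do under eq_bigr => j _ do
  rewrite sum_repr_conj mxE mxtrace_delta.
(* A matrix unit has nonzero trace only if i = j, which leaves n equal terms. *)
transitivity (\sum_(i < n) #|G|%:R / n%:R : C).
  apply: eq_bigr => i _; rewrite (bigD1 i) //= big1 ?addr0.
    by rewrite eqxx mulr1.
  by move=> j ji; rewrite eq_sym (negPf ji).
by rewrite sumr_const card_ord -[LHS]mulr_natr mulfVK.
Qed.

(** Instead of Cauchy-Schwarz, 2x <= x^2 + 1 is summed over G; the right-hand side then totals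
    2|G|. *)
Lemma sum_norm_character_le : \sum_(g in G) `|\tr (rG g)| <= #|G|%:R :> C.
Proof.
rewrite -(ler_pM2l (ltr0n C 2)).
apply: (@le_trans _ _ (\sum_(g in G) (`|\tr (rG g)| ^+ 2 + 1))); last first.
  by rewrite big_split /= sum_sqr_norm_character sumr_const mulr_natl mulr2n.
rewrite mulr_sumr ler_sum // => g _; rewrite -subr_ge0.
have -> (x : C) : x ^+ 2 + 1 - 2 * x = (x - 1) ^+ 2.
  by rewrite sqrrB1 mulr_natl addrAC.
by rewrite real_exprn_even_ge0 // realB ?normr_real ?real1.
Qed.

End CharacterNorm.

(** * Fourier inversion and the transform of class-invariant functions *)

Section Fourier.

Variables (R : realType) (gT : finGroupType) (G : {group gT}).
Implicit Types (P mu nu : gT -> R) (alpha : Ghat R G).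

Lemma rho_irr alpha : mx_irreducible (irr_repr alpha).
Proof. exact: socle_irr. Qed.

Lemma irr_dim_neq0 alpha : irr_dim alpha != 0.
Proof. by rewrite pnatr_eq0 -lt0n irr_degree_gt0. Qed.

(** Both sides are the character of the regular representation, which contains each [alpha] with
    multiplicity equal to its degree. *)
Lemma sum_irr_dim_ch g : g \in G ->
  \sum_(alpha : Ghat R G) irr_dim alpha * ch alpha g = #|G|%:R * (g == 1%g)%:R.
Proof.
move=> Gg; rewrite -(regular_mxtrace _ _ _ _ Gg) (mxtrace_regular_pchar (Ghat R G)) //.
- by apply: eq_bigr => alpha _; rewrite mulr_natl.
(* Maschke's condition: in characteristic 0 no prime divisor of the order of G is excluded. *)
- apply: sub_in_pnat (pnat_pi (cardG_gt0 G)) => p _ _.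
  by rewrite inE /= (pchar_num R[i]).
- exact: group_closure_closed_field.
Qed.

(** Write f(g) as a sum over h of f(h) times the indicator of h g^-1 = 1, and expand the indicator
    by [sum_irr_dim_ch]. *)
Lemma fourier_inversion (f : gT -> R[i]) g : g \in G ->
  f g = #|G|%:R^-1 *
    \sum_(alpha : Ghat R G)
       irr_dim alpha * \tr (fourier f alpha *m rho alpha g^-1%g).
Proof.
move=> Gg; have cG_neq0 : #|G|%:R != 0 :> R[i] by rewrite pnatr_eq0 -lt0n.
transitivity (#|G|%:R^-1 * \sum_(h in G) f h *
    \sum_(alpha : Ghat R G) irr_dim alpha * ch alpha (h * g^-1)%g).
  transitivity (#|G|%:R^-1 * \sum_(h in G) f h * (#|G|%:R * (h == g)%:R)).
    rewrite (bigD1 g) //= eqxx mulr1.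
    rewrite big1 ?addr0 => [|h /andP[_ hg]]; first by rewrite mulrC mulfK.
    by rewrite (negPf hg) !mulr0.
  congr (_ * _); apply: eq_bigr => h Gh; congr (_ * _).
  by rewrite eq_mulgV1 -sum_irr_dim_ch // groupM ?groupV.
congr (_ * _); under eq_bigr do rewrite mulr_sumr.
rewrite exchange_big /=; apply: eq_bigr => alpha _.
rewrite mulmx_suml raddf_sum mulr_sumr; apply: eq_bigr => h Gh /=.
rewrite /ch /rho repr_mxM ?groupV // -scalemxAl mxtraceZ.
by rewrite mulrCA.
Qed.

Lemma fourier_convol mu nu alpha :
  fourier (fun g => (convol G mu nu g)%:C) alpha =
  fourier (fun g => (mu g)%:C) alpha *m fourier (fun g => (nu g)%:C) alpha.
Proof.
transitivity (\sum_(h in G) \sum_(g in G)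
    ((mu h)%:C * (nu (h^-1 * g)%g)%:C) *: rho alpha g).
  rewrite exchange_big /=; apply: eq_bigr => g Gg.
  rewrite /convol rmorph_sum scaler_suml; apply: eq_bigr => h Gh.
  by rewrite rmorphM.
rewrite mulmx_suml; apply: eq_bigr => h Gh.
rewrite (reindex_inj (mulgI h)) mulmx_sumr /=.
apply: eq_big => [g|g]; rewrite groupMl // => Gg.
by rewrite mulKg /rho repr_mxM // -scalemxAl -scalemxAr scalerA.
Qed.

Lemma fourier_dirac1 alpha :
  fourier (fun g => (dirac1 R g)%:C) alpha = 1%:M.
Proof.
rewrite /fourier (bigD1 1%g) //= big1 ?addr0 => [|g /andP[_ g1]].
  by rewrite /dirac1 eqxx /rho repr_mx1 scale1r.
by rewrite /dirac1 (negPf g1) scale0r.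
Qed.

Lemma fourier_class_invariant P alpha : class_invariant G P ->
  fourier (fun g => (P g)%:C) alpha = (fourier_ratio P alpha)%:M.
Proof.
move=> Pcl; apply: (mx_irr_cent_scalar _ _ _ _ _ (rho_irr alpha)).
by apply: centgmx_class_sum => g h Gg Gh; rewrite Pcl.
Qed.

Lemma fourier_convol_pow P t alpha : class_invariant G P ->
  fourier (fun g => (convol_pow G P t g)%:C) alpha =
  (fourier_ratio P alpha ^+ t)%:M.
Proof.
move=> Pcl; elim: t => [|t IHt]; first exact: fourier_dirac1.
by rewrite exprS scalar_mxM -IHt -fourier_class_invariant // -fourier_convol.
Qed.

Lemma convol_powE P t g : class_invariant G P -> g \in G ->
  (convol_pow G P t g)%:C = #|G|%:R^-1 *
    \sum_(alpha : Ghat R G) irr_dim alpha * fourier_ratio P alpha ^+ t * (ch alpha g)^*.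
Proof.
move=> Pcl Gg; rewrite (fourier_inversion (fun g => (convol_pow G P t g)%:C)) //.
congr (_ * _); apply: eq_bigr => alpha _.
by rewrite fourier_convol_pow // mul_scalar_mx mxtraceZ mulrA mxtrace_reprV.
Qed.

Lemma irr_dim_triv : irr_dim (triv R G) = 1.
Proof. by rewrite /irr_dim degree_irr1. Qed.

Lemma ch_triv g : g \in G -> ch (triv R G) g = 1.
Proof.
move=> Gg; rewrite /ch /rho irr1_repr // mxtrace1; exact: irr_dim_triv.
Qed.

Lemma fourier_ratio_triv P : is_prob G P -> fourier_ratio P (triv R G) = 1.
Proof.
move=> [_ P1]; rewrite /fourier_ratio irr_dim_triv divr1 raddf_sum /=.
transitivity (\sum_(g in G) (P g)%:C); last by rewrite -rmorph_sum P1.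
by apply: eq_bigr => g Gg; rewrite mxtraceZ -/(ch _ _) ch_triv // mulr1.
Qed.

Lemma convol_pow_unifE P t g : is_prob G P -> class_invariant G P ->
  g \in G ->
  (convol_pow G P t g - unif R G g)%:C = #|G|%:R^-1 *
    \sum_(alpha in Ghat_star R G)
       irr_dim alpha * fourier_ratio P alpha ^+ t * (ch alpha g)^*.
Proof.
move=> Ppr Pcl Gg; rewrite rmorphB /= convol_powE // (bigD1 (triv R G)) //=.
rewrite irr_dim_triv fourier_ratio_triv // ch_triv // expr1n rmorph1 !mulr1.
rewrite mulrDr mulr1 /unif fmorphV rmorph_nat addrC addrA addNr add0r.
by congr (_ * _); apply: eq_bigl => alpha; rewrite !inE.
Qed.

End Fourier.

Theorem lemma2p1 (R : realType) (gT : finGroupType) (G : {group gT})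
    (P : gT -> R) (hP : is_prob G P) (hcl : class_invariant G P)
    (t : nat) (S : {set Ghat R G}) (hS : S \subset Ghat_star R G) :
  `| (dist1 G (convol_pow G P t) (unif R G))%:C
     - #|G|%:R^-1 * \sum_(g in G)
         `| \sum_(alpha in S) irr_dim alpha * fourier_ratio P alpha ^+ t * (ch alpha g)^* | |
  <= \sum_(alpha in Ghat_star R G :\: S) irr_dim alpha * `| fourier_ratio P alpha | ^+ t.
Proof.
pose F g (alpha : Ghat R G) := irr_dim alpha * fourier_ratio P alpha ^+ t * (ch alpha g)^*%R.
have cG_gt0 : 0 < #|G|%:R^-1 :> R[i] by rewrite invr_gt0 ltr0n.
have normR (x : R) : `|x|%:C = `|x%:C|.
  by rewrite normc_def /= expr0n /= addr0 sqrtr_sqr.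
have -> : (dist1 G (convol_pow G P t) (unif R G))%:C =
    #|G|%:R^-1 * \sum_(g in G) `|\sum_(alpha in Ghat_star R G) F g alpha|.
  rewrite /dist1 rmorph_sum mulr_sumr; apply: eq_bigr => g Gg /=.
  by rewrite normR convol_pow_unifE // normrM gtr0_norm.
rewrite -mulrBr -sumrB normrM gtr0_norm //.
apply: (@le_trans _ _ (#|G|%:R^-1 * \sum_(g in G)
    \sum_(alpha in Ghat_star R G :\: S)
      irr_dim alpha * `|fourier_ratio P alpha| ^+ t * `|ch alpha g|)).
  rewrite ler_pM2l //; apply: le_trans (ler_norm_sum _ _ _) _.
  (* The reverse triangle inequality bounds the difference of moduli by the modulus of the
     difference; as S lies in [Ghat_star], that difference is the sum over the complement of S. *)
  apply: ler_sum => g Gg; apply: le_trans (ler_dist_dist _ _) _.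
  rewrite (big_setID S) /= (setIidPr hS) [X in X - _]addrC addrK.
  apply: le_trans (ler_norm_sum _ _ _) _; apply: ler_sum => alpha _.
  by rewrite 2!normrM norm_conjC normrX normr_nat.
(* With [alpha] outermost, it remains to see that the average of the modulus of [ch alpha] over G is
   at most 1. *)
rewrite exchange_big mulr_sumr; apply: ler_sum => alpha _ /=.
rewrite -mulr_sumr mulrCA ler_piMr ?mulr_ge0 ?ler0n ?exprn_ge0 //.
rewrite mulrC ler_pdivrMr ?ltr0n // mul1r.
exact: (sum_norm_character_le _ _ _ _ _ (rho_irr _ _ _ alpha)).
Qed.
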